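(* Let $H$ be a complex Hilbert space with an orthonormal basis $\{e_k\}_{k=0}^{\infty}$ and let $n\ge 1$ be an integer. Let $T:H\to H$ be a bounded weighted shift of multiplicity $n$ with respect to $\{e_k\}$ (that is, $Te_k=a_ke_{k+n}$ for all $k\ge 0$, for some complex numbers $a_k$) which is hyponormal and satisfies $\ker([T^*,T])=\{0\}$. Let $D:H\to H$ be a bounded diagonal operator with respect to the same basis (that is, $De_k=d_ke_k$ for all $k\ge0$, for some complex numbers $d_k$). Set $$J=[T^*,T]^{-1/2}\big([T^*,D]+[D^*,T]\big)[T^*,T]^{-1/2}.$$ Then for every $c\in\mathbb{C}$, the operator $T+cD$ is hyponormal if and only if $\|cJ\|\le 1$.
   Context: For operators $A,B$ write $[A,B]=AB-BA$. A bounded operator $S$ on a Hilbert space is hyponormal if $[S^*,S]\ge 0$. Under the hypotheses $[T^*,T]$ is diagonal in the basis $\{e_k\}$ with strictly positive diagonal entries, and $[T^*,T]^{-1/2}$ denotes the (possibly unbounded) diagonal operator whose diagonal entries are the $-1/2$ powers of these. Accordingly $J$ is a possibly unbounded operator, defined on the dense subspace $\mathrm{span}\{e_k:k\ge0\}$ of finite linear combinations of basis vectors, which it maps into itself. The norm $\|cJ\|\in[0,\infty]$ is the supremum of $\|cJf\|$ over unit vectors $f$ in this subspace. *)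

(* Defs.v *)
From HB Require Import structures.
From mathcomp Require Import all_boot all_order all_algebra.
From mathcomp Require Export complex.
From mathcomp Require Import all_classical all_reals all_analysis.

Set Implicit Arguments.
Unset Strict Implicit.
Unset Printing Implicit Defensive.

Import Order.TTheory GRing.Theory Num.Theory.
Import numFieldNormedType.Exports.

Local Open Scope classical_set_scope.
Local Open Scope ring_scope.

(* A complex Hilbert space is a complete normed module [H] over [R[i]] together
   with a positive definite Hermitian form [ip] (linear in its first argument,
   conjugate-linear in the second) that induces the norm of [H]. *)
Definition hilbert_norm (R : realType) (H : completeNormedModType R[i])
    (ip : {dot H for Num.conj}) : Prop :=
  forall x : H, `|x| = sqrtC (ip x x).

Section operators.
Context {R : realType} {H : completeNormedModType R[i]}.
Implicit Types (A B : H -> H) (ip : {dot H for Num.conj}) (e : nat -> H).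

Definition commutator A B : H -> H := (A \o B) \- (B \o A).

Definition is_adjoint ip A B : Prop := forall x y, ip (A x) y = ip x (B y).

(* The adjoint is unique, and by the Riesz representation theorem it exists for
   every bounded operator; the default value 0 is then never used. *)
Definition adjoint ip A : H -> H := xget (fun=> 0) [set B | is_adjoint ip A B].

(* In [R[i]], [0 <= z] means that [z] is real and nonnegative. *)
Definition positive_op ip A : Prop := forall x, 0 <= ip (A x) x.

(* To be used for bounded [A]; boundedness is not part of the predicate. *)
Definition hyponormal ip A : Prop :=
  positive_op ip (commutator (adjoint ip A) A).

Definition finite_span e : set H :=
  [set x | exists (N : nat) (a : nat -> R[i]), x = \sum_(k < N) a k *: e k].

Definition orthonormal_basis ip e : Prop :=
  (forall j k, ip (e j) (e k) = (j == k)%:R) /\ dense (finite_span e).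

Definition weighted_shift e (n : nat) A : Prop :=
  exists a : nat -> R[i], forall k, A (e k) = a k *: e (k + n)%N.

Definition diagonal_op e A : Prop :=
  exists d : nat -> R[i], forall k, A (e k) = d k *: e k.

(* The operator A^(-1/2) on [finite_span e], for [A] diagonal in the orthonormal
   basis [e] with strictly positive diagonal entries [ip (A (e k)) (e k)].  The
   sum has finite support when [f] is in [finite_span e]; the values outside
   this domain (0 for an infinite support) are meaningless. *)
Definition diag_inv_sqrt ip e A (f : H) : H :=
  \sum_(k \in [set: nat]) ((sqrtC (ip (A (e k)) (e k)))^-1 * ip f (e k)) *: e k.

(* Every factor maps [finite_span e] into itself, hence only the values of
   [diag_inv_sqrt] on its domain matter for those of this operator there. *)
Definition J_op ip e T D : H -> H :=
  let K := diag_inv_sqrt ip e (commutator (adjoint ip T) T) in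
  K \o (commutator (adjoint ip T) D \+ commutator (adjoint ip D) T) \o K.

(* Norm in [0, +oo] of an operator with domain [finite_span e]; the norm of [H]
   takes values in [R[i]], so its real part is used. *)
Definition span_opnorm e A : \bar R :=
  ereal_sup [set (complex.Re `|A f|)%:E |
             f in finite_span e `&` [set f | `|f| = 1]].

End operators.

(* Main.v *)
Require Import Defs.
From HB Require Import structures.
From mathcomp Require Import all_boot all_order all_algebra complex.
From mathcomp Require Import all_classical all_reals all_analysis.
From mathcomp Require Import ring.

(* On the span of the basis, [(T + cD)^*, T + cD] = P + c M + (c M)^* with
   P = [T^*, T] diagonal and positive and M = [T^*, D] a weighted backward shift
   by n, since [D^*, D] = 0; by density and boundedness it suffices to test
   positivity on the span.  The diagonal unitary e_k |-> w ^ (k / n) e_k turns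
   M into w M, so positivity amounts to 2 |c| |Re <M g, g>| <= <P g, g> for
   all g in the span.  Substituting g = P^(-1/2) f, this bounds the numerical
   radius of the symmetric operator |c| J by 1, which by polarization is the
   same as ||c J|| <= 1. *)

Set Implicit Arguments.
Unset Strict Implicit.
Unset Printing Implicit Defensive.

Import Order.TTheory GRing.Theory Num.Theory.
Import numFieldNormedType.Exports.

Local Open Scope classical_set_scope.
Local Open Scope ring_scope.

(** * The Hermitian form: calculus, adjoints, Cauchy-Schwarz *)

Section InnerProduct.
Context {R : realType} {H : completeNormedModType R[i]}.
Variable ip : {dot H for Num.conj}.
Implicit Types (a : R[i]) (x y z : H).

Lemma ipDl x y z : ip (x + y) z = ip x z + ip y z.
Proof. exact: linearDl. Qed.

Lemma ipDr x y z : ip x (y + z) = ip x y + ip x z.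
Proof. exact: linearDr. Qed.

Lemma ipNl x y : ip (- x) y = - ip x y.
Proof. exact: linearNl. Qed.

Lemma ipNr x y : ip x (- y) = - ip x y.
Proof. exact: linearNr. Qed.

Lemma ipBl x y z : ip (x - y) z = ip x z - ip y z.
Proof. exact: linearBl. Qed.

Lemma ipBr x y z : ip x (y - z) = ip x y - ip x z.
Proof. exact: linearBr. Qed.

Lemma ipZl a x y : ip (a *: x) y = a * ip x y.
Proof. exact: linearZl_LR. Qed.

Lemma ipZr a x y : ip x (a *: y) = a^* * ip x y.
Proof. exact: linearZr_LR. Qed.

Lemma ip0l x : ip 0 x = 0.
Proof. exact: linear0l. Qed.

Lemma ip0r x : ip x 0 = 0.
Proof. exact: linear0r. Qed.

Lemma ip_suml (I : Type) (r : seq I) (P : pred I) (F : I -> H) x :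
  ip (\sum_(i <- r | P i) F i) x = \sum_(i <- r | P i) ip (F i) x.
Proof. exact: linear_sumlz. Qed.

Lemma ip_sumr (I : Type) (r : seq I) (P : pred I) (F : I -> H) x :
  ip x (\sum_(i <- r | P i) F i) = \sum_(i <- r | P i) ip x (F i).
Proof. exact: linear_sumr. Qed.

Lemma ip_conj x y : ip y x = (ip x y)^*.
Proof. by rewrite (hermC ip) mul1r. Qed.

Lemma is_adjoint_sym (A B : H -> H) x y :
  is_adjoint ip A B -> ip (B x) y = ip x (A y).
Proof. by move=> AB; rewrite ip_conj -AB -ip_conj. Qed.

Lemma ip_ext x y : (forall z, ip z x = ip z y) -> x = y.
Proof.
move=> xy; apply/subr0_eq/eqP; apply: contraT => /(@neq0_dnorm_gt0 _ _ _ ip).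
by rewrite ipBr xy subrr ltxx.
Qed.

(** Since adjoints are unique, the choice made by [xget] can only return [B]; this lets a known
    linear map replace [adjoint ip A]. *)
Lemma adjoint_eq (A B : H -> H) : is_adjoint ip A B -> adjoint ip A = B.
Proof.
move=> AB; rewrite /adjoint; case: xgetP => [C _ AC|/(_ B) //].
by apply/funext => y; apply: ip_ext => z; rewrite -AB -AC.
Qed.

Lemma ip_commutator (A B : H -> H) x :
  is_adjoint ip A B ->
  ip (commutator B A x) x = ip (A x) (A x) - ip (B x) (B x).
Proof.
by move=> AB; rewrite /commutator /= ipBl (is_adjoint_sym (A x) x AB) (AB (B x)).
Qed.

Hypothesis ipN : hilbert_norm ip.

Lemma ip_normE x : ip x x = `|x| ^+ 2.
Proof. by rewrite ipN sqrtCK. Qed.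

Lemma cauchy_schwarz x y : `|ip x y| <= `|x| * `|y|.
Proof.
have [->|y0] := eqVneq y 0; first by rewrite ip0r !normr0 mulr0.
have y2 : 0 < `|y| ^+ 2 by rewrite exprn_gt0 // normr_gt0.
rewrite -(ler_pXn2r (n := 2)) ?nnegrE ?mulr_ge0 //.
rewrite exprMn -subr_ge0 -(pmulr_rge0 _ y2).
(* The usual projection remainder of [x] along [y], multiplied by [|y|^2] so that the identity stays
   polynomial. *)
suff -> : `|y| ^+ 2 * (`|x| ^+ 2 * `|y| ^+ 2 - `|ip x y| ^+ 2) =
    ip (`|y| ^+ 2 *: x - ip x y *: y) (`|y| ^+ 2 *: x - ip x y *: y).
  by rewrite ip_normE exprn_ge0.
rewrite ipBl !ipBr !ipZl !ipZr !(ip_normE x) !(ip_normE y) normCK (ip_conj x y).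
rewrite (geC0_conj (exprn_ge0 2 (normr_ge0 y))).
move: (ip x y) (_^*) (`|x| ^+ 2) (`|y| ^+ 2) => a b u v.
by ring.
Qed.

End InnerProduct.

(** * Finite combinations of an orthonormal basis and their density *)

Section Span.
Context {R : realType} {H : completeNormedModType R[i]}.
Variables (ip : {dot H for Num.conj}) (e : nat -> H).
Hypothesis ipN : hilbert_norm ip.
Hypothesis eB : orthonormal_basis ip e.
Local Notation C := R[i].
Implicit Types (a : C) (f g : H).

Lemma ip_basis j k : ip (e j) (e k) = (j == k)%:R.
Proof. by have [-> //] := eB. Qed.

Lemma ip_sum_basis (x : nat -> C) N k :
  ip (\sum_(j < N) x j *: e j) (e k) = if (k < N)%N then x k else 0.
Proof.
rewrite ip_suml; case: ltnP => kN; last first.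
  rewrite big1 // => j _; rewrite ipZl ip_basis ltn_eqF ?mulr0 //.
  exact: leq_trans (ltn_ord j) kN.
rewrite (bigD1 (Ordinal kN)) //= ipZl ip_basis eqxx mulr1 big1 ?addr0 // => j jk.
by rewrite ipZl ip_basis -[k]/(val (Ordinal kN)) val_eqE (negPf jk) mulr0.
Qed.

(** Every larger length also works, so that two vectors can be expanded at a common one. *)
Lemma span_expand f : finite_span e f ->
  exists N, forall N', (N <= N')%N -> f = \sum_(k < N') ip f (e k) *: e k.
Proof.
move=> [N [x ->]]; exists N => N' NN'.
under [RHS]eq_bigr do rewrite ip_sum_basis.
rewrite (big_ord_widen N' (fun k => x k *: e k) NN') big_mkcond /=.
by apply: eq_bigr => i _; case: ifP => // _; rewrite scale0r.
Qed.

Lemma span_sum (x : nat -> C) N : finite_span e (\sum_(k < N) x k *: e k).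
Proof. by exists N, x. Qed.

Lemma span_basis k : finite_span e (e k).
Proof.
exists k.+1, (fun j => (j == k)%:R).
rewrite big_ord_recr /= eqxx scale1r big1 ?add0r //.
by move=> i _; rewrite (ltn_eqF (ltn_ord i)) scale0r.
Qed.

Lemma span_lincomb a f g :
  finite_span e f -> finite_span e g -> finite_span e (a *: f + g).
Proof.
move=> /span_expand[N fN] /span_expand[M gM].
rewrite (fN (maxn N M) (leq_maxl _ _)) (gM (maxn N M) (leq_maxr _ _)).
rewrite scaler_sumr -big_split /=.
under eq_bigr do rewrite scalerA -scalerDl.
exact: (span_sum (fun k => a * ip f (e k) + ip g (e k))).
Qed.

Lemma span0 : finite_span e 0.
Proof. by exists 0%N, (fun=> 0); rewrite big_ord0. Qed.

Lemma spanZ a f : finite_span e f -> finite_span e (a *: f).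
Proof.
move=> Vf; rewrite -[_ *: _]addr0; apply: span_lincomb => //.
exact: span0.
Qed.

Lemma spanD f g : finite_span e f -> finite_span e g -> finite_span e (f + g).
Proof. by move=> Vf Vg; rewrite -[f]scale1r; exact: span_lincomb. Qed.

Lemma spanB f g : finite_span e f -> finite_span e g -> finite_span e (f - g).
Proof. by move=> Vf Vg; rewrite -scaleN1r addrC; exact: span_lincomb. Qed.

Lemma span_linear (A : {linear H -> H}) f :
  (forall k, finite_span e (A (e k))) -> finite_span e f -> finite_span e (A f).
Proof.
move=> Ae [N [x ->]]; rewrite linear_sum.
elim/big_ind : _ => [|g h|k _]; [exact: span0|exact: spanD|].
by rewrite linearZ; apply: spanZ.
Qed.

Lemma span_approx x (eps : C) : 0 < eps ->
  exists2 f, finite_span e f & `|x - f| < eps.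
Proof.
move=> eps0; have [_ eD] := eB.
have [||f [xf Vf]] := eD (ball x eps); first by exists x; exact: ballxx.
  exact: ball_open.
by exists f; move: xf; rewrite -ball_normE.
Qed.

(** The difference [f - g] is orthogonal to the span. Were it nonzero, some [h] in the span would
    satisfy [|f - g - h| < |f - g|], against Cauchy-Schwarz for [f - g] and [f - g - h]. *)
Lemma ip_basis_ext f g : (forall k, ip f (e k) = ip g (e k)) -> f = g.
Proof.
move=> fg; apply/subr0_eq/eqP; rewrite -normr_le0.
have ortho h : finite_span e h -> ip (f - g) h = 0.
  move=> [N [x ->]]; rewrite ip_sumr big1 // => k _.
  by rewrite ipZr ipBl fg subrr mulr0.
rewrite real_leNgt ?normr_real //; apply/negP => d0.
have [h Vh hd] := span_approx (f - g) d0.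
suff : `|f - g| <= `|f - g - h| by rewrite (lt_geF hd).
have := cauchy_schwarz ipN (f - g) (f - g - h).
rewrite [ip _ _]ipBr (ortho h Vh) subr0 (ip_normE ipN) ger0_norm ?exprn_ge0 //.
by rewrite expr2 ler_pM2l.
Qed.

Lemma parseval f g : finite_span e g ->
  exists N, forall N', (N <= N')%N ->
    ip f g = \sum_(k < N') ip f (e k) * (ip g (e k))^*.
Proof.
move=> /span_expand[N gN]; exists N => N' /gN {1}->.
by rewrite ip_sumr; apply: eq_bigr => k _; rewrite ipZr mulrC.
Qed.

End Span.

(** * The operator [P^(-1/2)] on the span, for [P] diagonal and positive *)

Section DiagonalInverseSqrt.
Context {R : realType} {H : completeNormedModType R[i]}.
Variables (ip : {dot H for Num.conj}) (e : nat -> H).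
Hypothesis ipN : hilbert_norm ip.
Hypothesis eB : orthonormal_basis ip e.
Variables (P : {linear H -> H}) (p : nat -> R[i]).
Hypothesis P_diag : forall k, P (e k) = p k *: e k.
Hypothesis p_gt0 : forall k, 0 < p k.
Local Notation K := (diag_inv_sqrt ip e P).
Implicit Types (a : R[i]) (f g : H).

Lemma ip_diag f k : finite_span e f -> ip (P f) (e k) = p k * ip f (e k).
Proof.
move=> [N [x ->]]; rewrite (ip_sum_basis eB) linear_sum.
under eq_bigr do rewrite linearZ /= P_diag scalerA.
rewrite (ip_sum_basis eB (fun j => x j * p j)).
by case: ifP; rewrite ?mulr0 // mulrC.
Qed.

Lemma span_diag f : finite_span e f -> finite_span e (P f).
Proof.
apply: (span_linear eB) => k; rewrite P_diag; apply: (spanZ eB); exact: span_basis.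
Qed.

Lemma diag_inv_sqrtE f : finite_span e f ->
  exists2 N, K f = \sum_(k < N) ((sqrtC (p k))^-1 * ip f (e k)) *: e k &
    forall k, (N <= k)%N -> ip f (e k) = 0.
Proof.
move=> [N [x ->]]; exists N => [|k Nk]; last by rewrite (ip_sum_basis eB) ltnNge Nk.
rewrite /diag_inv_sqrt (fsbigE (index_iota 0 N)) ?iota_uniq //; last first.
  move=> k _; rewrite mem_index_iota leq0n /= => /negPf kN.
  by rewrite (ip_sum_basis eB) kN mulr0 scale0r.
rewrite big_mkcond /= big_mkord; apply: eq_bigr => k _.
by rewrite in_setT P_diag ipZl (ip_basis eB) eqxx mulr1.
Qed.

Lemma span_diag_inv_sqrt f : finite_span e f -> finite_span e (K f).
Proof.
move=> /diag_inv_sqrtE[N -> _].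
exact: (span_sum e (fun k => (sqrtC (p k))^-1 * ip f (e k))).
Qed.

Lemma ip_diag_inv_sqrt f k : finite_span e f ->
  ip (K f) (e k) = (sqrtC (p k))^-1 * ip f (e k).
Proof.
move=> /diag_inv_sqrtE[N -> f0].
rewrite (ip_sum_basis eB (fun k => (sqrtC (p k))^-1 * ip f (e k))).
by case: ltnP => // /f0 ->; rewrite mulr0.
Qed.

Lemma diag_inv_sqrtK f : finite_span e f -> K (P (K f)) = f.
Proof.
move=> Vf; have VKf := span_diag_inv_sqrt Vf; apply: (ip_basis_ext ipN eB) => k.
rewrite ip_diag_inv_sqrt ?ip_diag ?ip_diag_inv_sqrt //; last exact: span_diag.
rewrite mulrCA [X in _ * X]mulrA -expr2 exprVn sqrtCK mulrA divff ?mul1r //.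
by rewrite gt_eqF.
Qed.

(** Shows that [K] maps the span onto itself, with [K (P f)] as a preimage of [f]. *)
Lemma diag_inv_sqrt_surj f : finite_span e f -> K (K (P f)) = f.
Proof.
move=> Vf; have VPf := span_diag Vf; apply: (ip_basis_ext ipN eB) => k.
rewrite !ip_diag_inv_sqrt ?ip_diag //; last exact: span_diag_inv_sqrt.
by rewrite mulrA -expr2 exprVn sqrtCK mulrA mulVf ?mul1r // gt_eqF.
Qed.

Lemma diag_inv_sqrt_lin a f g : finite_span e f -> finite_span e g ->
  K (a *: f + g) = a *: K f + K g.
Proof.
move=> Vf Vg; apply: (ip_basis_ext ipN eB) => k.
rewrite ipDl ipZl !ip_diag_inv_sqrt //; last exact: (span_lincomb eB).
by rewrite ipDl ipZl mulrDr mulrCA.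
Qed.

(** The diagonal entries of [K] are real, being inverse square roots of positive numbers. *)
Lemma diag_inv_sqrt_sym f g : finite_span e f -> finite_span e g ->
  ip (K f) g = ip f (K g).
Proof.
move=> Vf Vg; have VKg := span_diag_inv_sqrt Vg.
have [N gN] := parseval eB f VKg; have [M gM] := parseval eB (K f) Vg.
rewrite (gN _ (leq_maxl N M)) (gM _ (leq_maxr N M)); apply: eq_bigr => k _.
rewrite !ip_diag_inv_sqrt // rmorphM mulrCA mulrA; congr (_ * _ * _).
by apply/esym/geC0_conj; rewrite invr_ge0 sqrtC_ge0 ltW.
Qed.

(** As [K P K] is the identity on the span, substituting [g = K f] turns the form of [P] into a
    squared norm. *)
Lemma diag_inv_sqrt_norm f : finite_span e f -> ip (P (K f)) (K f) = ip f f.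
Proof.
move=> Vf; rewrite -diag_inv_sqrt_sym ?diag_inv_sqrtK //.
exact/span_diag/span_diag_inv_sqrt.
Qed.

Lemma diag_inv_sqrtZ a f : finite_span e f -> K (a *: f) = a *: K f.
Proof.
move=> Vf; apply: (ip_basis_ext ipN eB) => k.
rewrite ipZl !ip_diag_inv_sqrt //; last exact: (spanZ eB).
by rewrite ipZl mulrCA.
Qed.

Lemma diag_inv_sqrt0 : K 0 = 0.
Proof.
rewrite -[X in K X](scale0r 0) diag_inv_sqrtZ ?scale0r //.
exact: span0.
Qed.

(** * Bounding the form of [W] by that of [P], versus bounding the norm of [J] *)

Section NormBound.
Variables (W : {linear H -> H}) (t : R[i]).
Hypothesis We : forall k, finite_span e (W (e k)).
Hypothesis W_sym : is_adjoint ip W W.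
Hypothesis t_ge0 : 0 <= t.
Local Notation J := (K \o W \o K).

Lemma span_compressed f : finite_span e f -> finite_span e (J f).
Proof.
move=> Vf; apply: span_diag_inv_sqrt; apply: (span_linear eB We).
exact: span_diag_inv_sqrt.
Qed.

Lemma ip_compressed f g : finite_span e f -> finite_span e g ->
  ip (J f) g = ip (W (K f)) (K g).
Proof.
move=> Vf Vg; rewrite diag_inv_sqrt_sym //; apply: (span_linear eB We).
exact: span_diag_inv_sqrt.
Qed.

(* With [|f| = 1] and [h = t J f], polarization of the form at [f] and [h]
   bounds [4 |h|^2] by [|f + h|^2 + |f - h|^2 = 2 + 2 |h|^2]. *)
Lemma form_bound_norm f :
  (forall g, finite_span e g -> t * `|ip (W g) g| <= ip (P g) g) ->
  finite_span e f -> `|f| = 1 -> t * `|J f| <= 1.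
Proof.
move=> bnd Vf f1; set h := t *: J f.
have VJf := span_compressed Vf; have Vh : finite_span e h by exact: (spanZ eB).
have tN : `|h| = t * `|J f| by rewrite normrZ ger0_norm.
have bK g : finite_span e g -> `|t * ip (W (K g)) (K g)| <= ip g g.
  move=> Vg; rewrite normrM (ger0_norm t_ge0) -(diag_inv_sqrt_norm Vg).
  exact/bnd/span_diag_inv_sqrt.
have Kfh : K (f + h) = K f + K h.
  by have := diag_inv_sqrt_lin 1 Vf Vh; rewrite !scale1r.
have KfBh : K (f - h) = K f - K h.
  have := diag_inv_sqrt_lin (-1) Vh Vf.
  by rewrite !scaleN1r addrC => ->; rewrite addrC.
have fh : t * ip (W (K f)) (K h) = `|h| ^+ 2.
  by rewrite -ip_compressed // -ipZl -(ip_normE ipN).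
(* [W] is symmetric and [t] is real, so this is the conjugate of the previous cross term, which is
   real. *)
have hf : t * ip (W (K h)) (K f) = `|h| ^+ 2.
  rewrite W_sym ip_conj -ip_compressed // -[t]geC0_conj // -rmorphM /=.
  by rewrite -ipZl -/h (ip_normE ipN) geC0_conj ?exprn_ge0.
have polar : t * ip (W (K (f + h))) (K (f + h)) -
    t * ip (W (K (f - h))) (K (f - h)) = `|h| ^+ 2 *+ 4.
  rewrite Kfh KfBh (linearD W) (linearB W) !(ipDl, ipDr) !(ipNl, ipNr).
  rewrite [LHS](_ : _ = (t * ip (W (K f)) (K h)) *+ 2 +
      (t * ip (W (K h)) (K f)) *+ 2).
    by rewrite fh hf -mulrnDr.
  by ring.
have sum2 : ip (f + h) (f + h) + ip (f - h) (f - h) = 1 *+ 2 + `|h| ^+ 2 *+ 2.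
  rewrite !(ipDl, ipDr) !(ipNl, ipNr) !(ip_normE ipN) f1 expr1n.
  by ring.
have : `|h| ^+ 2 *+ 4 <= 1 *+ 2 + `|h| ^+ 2 *+ 2.
  rewrite -sum2 -[leLHS]ger0_norm ?mulrn_wge0 ?exprn_ge0 // -polar.
  apply: le_trans (ler_normB _ _) _; apply: lerD; apply: bK.
    exact: (spanD eB).
  exact: (spanB eB).
rewrite -[4%N]/(2 + 2)%N mulrnDr lerD2r lerMn2r /= => h1.
by rewrite -tN -(ler_pXn2r (n := 2)) ?nnegrE // expr1n.
Qed.

(** With [g = K f] the claim reads [t |<J f, f>| <= |f|^2]: extend the bound on unit vectors by
    homogeneity, then apply Cauchy-Schwarz. *)
Lemma norm_form_bound g :
  (forall f, finite_span e f -> `|f| = 1 -> t * `|J f| <= 1) ->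
  finite_span e g -> t * `|ip (W g) g| <= ip (P g) g.
Proof.
move=> bnd Vg; set f := K (P g).
have Vf : finite_span e f by exact/span_diag_inv_sqrt/span_diag.
have <- : K f = g by exact: diag_inv_sqrt_surj.
rewrite diag_inv_sqrt_norm // -ip_compressed // (ip_normE ipN).
have Jf : t * `|J f| <= `|f|.
  have [f0|f0] := eqVneq f 0.
    by rewrite f0 /= diag_inv_sqrt0 linear0 diag_inv_sqrt0 normr0 mulr0.
  have fN : 0 < `|f| by rewrite normr_gt0.
  have := bnd (`|f|^-1 *: f) (spanZ eB _ Vf).
  rewrite normrZ normfV normr_id mulVf ?gt_eqF // => /(_ erefl).
  rewrite /= diag_inv_sqrtZ // linearZ /= diag_inv_sqrtZ; last first.
    by apply: (span_linear eB We); exact: span_diag_inv_sqrt.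
  by rewrite normrZ normfV normr_id mulrCA ler_pdivrMl // mulr1.
apply: le_trans (_ : t * (`|J f| * `|f|) <= _).
  by rewrite ler_wpM2l // cauchy_schwarz.
by rewrite mulrA expr2 ler_wpM2r.
Qed.

End NormBound.

End DiagonalInverseSqrt.

(** * Diagonal unitaries acting on the forms of [P] and of a backward shift [M] *)

Section Rotation.
Context {R : realType} {H : completeNormedModType R[i]}.
Variables (ip : {dot H for Num.conj}) (e : nat -> H).
Hypothesis eB : orthonormal_basis ip e.
Variables (P : {linear H -> H}) (p : nat -> R[i]).
Hypothesis P_diag : forall k, P (e k) = p k *: e k.
Variables (M : {linear H -> H}) (n : nat).
Hypothesis n_gt0 : (0 < n)%N.
Hypothesis M_shift : forall k j, k != (j + n)%N -> ip (M (e k)) (e j) = 0.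
Implicit Types (c u w : R[i]) (g : H).

Lemma ip_sum_sum (A : {linear H -> H}) (x : nat -> R[i]) N :
  ip (A (\sum_(k < N) x k *: e k)) (\sum_(j < N) x j *: e j) =
  \sum_(k < N) \sum_(j < N) x k * (x j)^* * ip (A (e k)) (e j).
Proof.
rewrite (linear_sum A) ip_suml; apply: eq_bigr => k _.
rewrite ip_sumr; apply: eq_bigr => j _.
by rewrite ipZr linearZ ipZl; ring.
Qed.

(* The diagonal unitary [e_k |-> w ^ (k / n) e_k] commutes with [P] and
   multiplies the form of [M] by [w]. *)
Lemma rotate_span w g : `|w| = 1 -> finite_span e g ->
  exists g', [/\ finite_span e g', ip (M g') g' = w * ip (M g) g &
                 ip (P g') g' = ip (P g) g].
Proof.
move=> w1 [N [x ->]].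
have wX m : w ^+ m * (w ^+ m)^* = 1 by rewrite -normCK normrX w1 !expr1n.
exists (\sum_(k < N) (w ^+ (k %/ n) * x k) *: e k).
split; first exact: (span_sum e (fun k => w ^+ (k %/ n) * x k)).
- rewrite (ip_sum_sum M (fun k => w ^+ (k %/ n) * x k)) (ip_sum_sum M) mulr_sumr.
  apply: eq_bigr => k _; rewrite mulr_sumr; apply: eq_bigr => j _.
  have [kj|/M_shift ->] := eqVneq (k : nat) (j + n)%N; last by rewrite !mulr0.
  (* From [k = j + n] follows [k / n = j / n + 1]: the phases cancel up to one factor [w]. *)
  rewrite {1}kj divnDr ?dvdnn // divnn n_gt0 addn1 exprS !rmorphM.
  by rewrite -[w in RHS]mulr1 -(wX (j %/ n)%N); ring.
- rewrite (ip_sum_sum P (fun k => w ^+ (k %/ n) * x k)) (ip_sum_sum P).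
  apply: eq_bigr => k _; apply: eq_bigr => j _.
  rewrite P_diag ipZl (ip_basis eB).
  have [kj|_] := eqVneq (k : nat) j; last by rewrite !mulr0.
  by rewrite kj -[p j in RHS]mul1r -(wX (j %/ n)%N) !rmorphM; ring.
Qed.

Lemma unit_phase u : exists2 w, `|w| = 1 & w * u = `|u|.
Proof.
have [->|u0] := eqVneq u 0; first by exists 1; rewrite ?normr1 // mulr0 normr0.
by exists (`|u| / u); rewrite ?divfK // normf_div normr_id divff // normr_eq0.
Qed.

(** Both sides amount to [2 |c| |<M g, g>| <= <P g, g>] on the span, since a rotation of [g] gives
    [<M g, g>] any desired phase and keeps [<P g, g>]. *)
Lemma rotation_bound c :
  (forall g, finite_span e g ->
    0 <= ip (P g) g + (c * ip (M g) g + (c * ip (M g) g)^*)) <->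
  (forall g, finite_span e g ->
    `|c| * `|ip (M g) g + (ip (M g) g)^*| <= ip (P g) g).
Proof.
split=> hyp g Vg.
- have [w w1 wu] := unit_phase (c * ip (M g) g).
  (* The sign in [- w] makes [c <M g', g'>] equal to [- |c <M g, g>|], the worst case of the
     hypothesis. *)
  have [|g' [Vg' Mg' Pg']] := @rotate_span (- w) g _ Vg; first by rewrite normrN.
  have := hyp g' Vg'; rewrite Mg' Pg' mulrCA mulNr wu rmorphN /=.
  rewrite geC0_conj // -opprD subr_ge0; apply: le_trans.
  rewrite normrM -mulrDr ler_wpM2l //.
  by apply: le_trans (ler_normD _ _) _; rewrite norm_conjC.
- have [w w1 wu] := unit_phase (ip (M g) g).
  (* Here [<M g', g'>] becomes [|<M g, g>|], so that taking twice the real part loses nothing. *)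
  have [g' [Vg' Mg' Pg']] := rotate_span w1 Vg.
  have := hyp g' Vg'; rewrite Mg' Pg' wu geC0_conj //.
  rewrite [`|_ + _|]ger0_norm; last exact: addr_ge0.
  move=> bnd; set u := c * ip (M g) g.
  have uR : - (u + u^*) \is Num.real.
    rewrite CrealE rmorphN rmorphD /= conjCK addrC; exact: eqxx.
  rewrite -[X in _ + X]opprK subr_ge0; apply: le_trans (real_ler_norm uR) _.
  rewrite normrN; apply: le_trans (ler_normD _ _) _.
  by rewrite norm_conjC normrM -mulrDr.
Qed.

End Rotation.

(** * Existence of adjoints, and hyponormality tested on the span *)

Section Adjoint.
Context {R : realType} {H : completeNormedModType R[i]}.
Variables (ip : {dot H for Num.conj}) (e : nat -> H).
Hypothesis ipN : hilbert_norm ip.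
Hypothesis eB : orthonormal_basis ip e.
Implicit Types (x y z : H).

Lemma sqr_norm_sum_basis (x : nat -> R[i]) (m N : nat) :
  `|\sum_(m <= k < N) x k *: e k| ^+ 2 = \sum_(m <= k < N) `|x k| ^+ 2.
Proof.
rewrite -(ip_normE ipN) ip_suml; apply: eq_big_nat => k kmN.
rewrite ip_sumr (bigD1_seq k) ?iota_uniq ?mem_index_iota //=.
rewrite big1 => [|j jk]; last first.
  by rewrite ipZl ipZr (ip_basis eB) eq_sym (negPf jk) !mulr0.
by rewrite ipZl ipZr (ip_basis eB) eqxx mulr1 addr0 normCK.
Qed.

Lemma norm_basis k : `|e k| = 1.
Proof.
apply/eqP; rewrite -(eqrXn2 (n := 2)) // expr1n -(ip_normE ipN) (ip_basis eB).
by rewrite eqxx.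
Qed.

(** By Pythagoras the sums of [|x k|^2] are bounded, hence converge and are Cauchy; Pythagoras again
    makes the vector series Cauchy, and [H] is complete. *)
Lemma sqr_summable_cvg (x : nat -> R[i]) (s : R[i]) :
  (forall N, `|series (fun k => x k *: e k) N| <= s) ->
  cvgn (series (fun k => x k *: e k)).
Proof.
(* Monotone convergence is used in [R], while norms live in [R[i]]; hence the real parts. *)
move=> bnd; pose b k : R := complex.Re `|x k|.
have bE k : (b k)%:C%C = `|x k| by rewrite RRe_real // normr_real.
have sumE m N : ((\sum_(m <= k < N) b k ^+ 2)%:C)%C =
    `|\sum_(m <= k < N) x k *: e k| ^+ 2.
  rewrite sqr_norm_sum_basis rmorph_sum; apply: eq_bigr => k _.
  by rewrite rmorphXn /= bE.
have s_real : s \is Num.real by apply: ger0_real; apply: le_trans (normr_ge0 _) (bnd 0%N).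
have b_cvg : cvgn (series (fun k => b k ^+ 2)).
  apply: nondecreasing_is_cvgn.
    by apply: nondecreasing_series => k _ _; exact: sqr_ge0.
  exists (complex.Re s ^+ 2) => _ [N _ <-].
  rewrite -lecR sumE rmorphXn /= RRe_real // ler_pXn2r ?nnegrE //.
    exact: bnd.
  exact: le_trans (normr_ge0 _) (bnd 0%N).
move/cauchy_cvgP/cauchy_seriesP: b_cvg => b_cauchy.
apply/cauchy_cvgP/cauchy_seriesP => eps eps0.
have eps_real : eps \is Num.real by exact: gtr0_real.
have eps0' : 0 < complex.Re eps by rewrite -ltcR RRe_real.
apply: filterS (b_cauchy _ (exprn_gt0 2 eps0')) => N /=.
rewrite ger0_norm; last by apply: sumr_ge0 => k _; exact: sqr_ge0.
rewrite -ltcR sumE rmorphXn /= RRe_real //.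
by rewrite ltr_pXn2r ?nnegrE // ltW.
Qed.

(** Riesz representation of [phi = <A _, y>] by the series of [(phi (e k))^* e k]. From
    [|S N|^2 = phi (S N) <= r |y| |S N|] its partial sums are bounded, so it converges to some [z];
    agreement with [<_, z>] passes from the basis to the span, then to [H] by density. *)
Lemma exists_adjoint_at (A : {linear H -> H}) (r : R[i]) y :
  0 < r -> (forall x, `|A x| <= r * `|x|) ->
  exists z, forall x, ip (A x) y = ip x z.
Proof.
move=> r0 Ar; pose phi x := ip (A x) y; pose c k := (phi (e k))^*.
have phi_le x : `|phi x| <= r * `|y| * `|x|.
  apply: le_trans (cauchy_schwarz ipN _ _) _.
  by rewrite mulrAC ler_wpM2r.
pose S := series (fun k => c k *: e k).
have phiS N : phi (S N) = `|S N| ^+ 2.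
  rewrite /S /series /= sqr_norm_sum_basis /phi linear_sum ip_suml.
  by apply: eq_bigr => k _; rewrite linearZ ipZl normCK conjCK.
have S_le N : `|S N| <= r * `|y|.
  have [->|S0] := eqVneq (S N) 0; first by rewrite normr0 mulr_ge0 // ltW.
  have SN : 0 < `|S N| by rewrite normr_gt0.
  rewrite -(ler_pM2r SN) -expr2; apply: le_trans (phi_le _).
  by rewrite phiS ger0_norm // exprn_ge0.
have /cvg_ex[z Sz] : cvgn S := sqr_summable_cvg S_le.
exists z; suff ze k : phi (e k) = ip (e k) z.
  move=> x; apply/subr0_eq/eqP; rewrite -normr_le0.
  (* [r |y| + |z|] is a Lipschitz constant of [phi - <_, z>]; adding [1] allows division by it. *)
  have s0 : 0 < r * `|y| + `|z| + 1.
    by rewrite ltr_wpDl // addr_ge0 // mulr_ge0 // ltW.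
  rewrite real_leNgt ?normr_real //; apply/negP => d0.
  have [f [N [a fE]] xf] := span_approx eB x (divr_gt0 d0 s0).
  have f0 : phi f = ip f z.
    rewrite fE /phi linear_sum !ip_suml; apply: eq_bigr => k _.
    by rewrite linearZ !ipZl -/(phi _) ze.
  suff : `|ip (A x) y - ip x z| <= (r * `|y| + `|z| + 1) * `|x - f|.
    by rewrite -ler_pdivrMl // mulrC (lt_geF xf).
  have -> : ip (A x) y - ip x z = phi (x - f) - ip (x - f) z.
    by rewrite /phi linearB !ipBl -/(phi f) f0 opprB addrA subrK.
  apply: le_trans (ler_normB _ _) _; rewrite -addrA mulrDl lerD //.
  rewrite mulrDl mul1r ler_wpDr // mulrC.
  exact: cauchy_schwarz.
apply/eqP; rewrite -subr_eq0 -normr_le0 real_leNgt ?normr_real //; apply/negP => d0.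
(* With [k < N] the coefficient of [S N] at [e k] is already the final one, so the defect at [e k]
   is [<e k, S N - z>]. *)
have [N kN SzN] : exists2 N, (k < N)%N & `|z - S N| < `|phi (e k) - ip (e k) z|.
  move/cvgrPdist_lt: Sz => /(_ _ d0) [N0 _ SN0].
  exists (maxn k.+1 N0); first exact: leq_maxl.
  by apply: SN0; exact: leq_maxr.
suff : `|phi (e k) - ip (e k) z| <= `|z - S N| by rewrite (lt_geF SzN).
have -> : phi (e k) - ip (e k) z = ip (e k) (S N - z).
  rewrite ipBr (ip_conj ip (S N) (e k)) /S /series /= big_mkord (ip_sum_basis eB) kN.
  by rewrite conjCK.
apply: le_trans (cauchy_schwarz ipN _ _) _.
by rewrite norm_basis mul1r distrC.
Qed.

(** The vectors representing [<A _, y>] are chosen for each [y] separately; their uniqueness makes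
    the choice linear in [y]. *)
Lemma exists_adjoint (A : {linear H -> H}) :
  bounded_near A (nbhs (0 : H)) -> exists B : {linear H -> H}, is_adjoint ip A B.
Proof.
move=> /linear_boundedP/pinfty_ex_gt0[r r0 Ar].
have [B AB] := choice (fun y => exists_adjoint_at y r0 Ar).
have Blin : linear B.
  move=> a y z; apply: (ip_ext (ip := ip)) => x.
  by rewrite ipDr ipZr -!AB ipDr ipZr.
pose L := GRing.isLinear.Build _ _ _ _ B Blin.
by exists (HB.pack_for {linear H -> H} B L).
Qed.

(* Hyponormality of [A] says [|A^* x| <= |A x|], a closed condition on [x]. *)
Lemma positive_commutator_span (A B : {linear H -> H}) :
  bounded_near A (nbhs (0 : H)) -> is_adjoint ip A B ->
  positive_op ip (commutator B A) <->
  forall f, finite_span e f -> 0 <= ip (commutator B A f) f.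
Proof.
move=> /linear_boundedP/pinfty_ex_gt0[r r0 Ar] AB.
have comE x : (0 <= ip (commutator B A x) x) = (`|B x| <= `|A x|).
  by rewrite (ip_commutator _ AB) subr_ge0 !(ip_normE ipN) ler_pXn2r ?nnegrE.
(* The adjoint inherits the bound [r], by Cauchy-Schwarz in [|B x|^2 = <A (B x), x>]. *)
have Br x : `|B x| <= r * `|x|.
  have [->|B0] := eqVneq (B x) 0; first by rewrite normr0 mulr_ge0 // ltW.
  have BN : 0 < `|B x| by rewrite normr_gt0.
  rewrite -(ler_pM2l BN) -expr2 -(ip_normE ipN) -AB -[leLHS]ger0_norm; last first.
    by rewrite AB (ip_normE ipN) exprn_ge0.
  apply: le_trans (cauchy_schwarz ipN _ _) _.
  by rewrite mulrCA mulrA ler_wpM2r.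
split=> [pos f _|pos x]; first exact: pos.
rewrite comE; apply/ler_addgt0Pr => eps eps0.
(* Replacing [x] by [f] costs [r |x - f|] once for [A] and once for [B]. *)
have r2 : 0 < r *+ 2 by rewrite pmulrn_lgt0.
have [f Vf xf] := span_approx eB x (divr_gt0 eps0 r2).
have := pos f Vf; rewrite comE => BAf.
have -> : B x = B f + B (x - f) by rewrite -linearD addrC subrK.
have Af : `|A f| <= `|A x| + r * `|x - f|.
  have -> : A f = A x - A (x - f) by rewrite -linearB opprB addrC subrK.
  by apply: le_trans (ler_normB _ _) _; rewrite lerD2l.
apply: le_trans (ler_normD _ _) _.
apply: le_trans (lerD (le_trans BAf Af) (Br _)) _.
by rewrite -addrA lerD2l -mulrDl -mulr2n -ler_pdivlMl // mulrC ltW.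
Qed.

End Adjoint.

(** * Adjoints and commutators of shifts and diagonal operators *)

Section Operators.
Context {R : realType} {H : completeNormedModType R[i]}.
Variables (ip : {dot H for Num.conj}) (e : nat -> H).
Hypothesis ipN : hilbert_norm ip.
Hypothesis eB : orthonormal_basis ip e.
Implicit Types (A B : {linear H -> H}) (c : R[i]) (f : H).

(** Makes commutators of linear maps usable as linear maps themselves. *)
HB.instance Definition _ A B :=
  GRing.Linear.copy (commutator A B) ((A \o B) \- (B \o A)).

Lemma is_adjointD A A' B B' c : is_adjoint ip A A' -> is_adjoint ip B B' ->
  is_adjoint ip (A \+ c \*: B) (A' \+ c^* \*: B').
Proof.
by move=> AA' BB' x y; rewrite /= ipDl ipDr ipZl ipZr conjCK AA' BB'.
Qed.

Lemma bounded_nearD A B c :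
  bounded_near A (nbhs (0 : H)) -> bounded_near B (nbhs (0 : H)) ->
  bounded_near (A \+ c \*: B) (nbhs (0 : H)).
Proof.
move=> /bounded_linear_continuous Ac /bounded_linear_continuous Bc.
apply: (continuous_linear_bounded 0 (f := A \+ c \*: B)).
apply: continuousD; first exact: Ac.
by apply: continuousZr; exact: Bc.
Qed.

(** Applied to [T] and [D], it makes [[T^*, D] + [D^*, T]] symmetric. *)
Lemma commutator_adjoint A A' B B' : is_adjoint ip A A' -> is_adjoint ip B B' ->
  is_adjoint ip (commutator B' A) (commutator A' B).
Proof.
move=> AA' BB' x y; rewrite /commutator /= ipBl ipBr.
by rewrite (is_adjoint_sym (A x) y BB') !AA' (is_adjoint_sym x (A' y) BB').
Qed.

Lemma adjoint_diagonal A A' (d : nat -> R[i]) k : is_adjoint ip A A' ->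
  (forall k, A (e k) = d k *: e k) -> A' (e k) = (d k)^* *: e k.
Proof.
move=> AA' Ae; apply: (ip_basis_ext ipN eB) => j.
rewrite (is_adjoint_sym _ _ AA') Ae ipZr ipZl (ip_basis eB).
by have [->|_] := eqVneq k j; rewrite ?mulr0.
Qed.

(** The adjoint shifts backwards and kills the first [n] basis vectors; the test guards against
    truncated subtraction. *)
Lemma adjoint_shift A A' (a : nat -> R[i]) n k : is_adjoint ip A A' ->
  (forall k, A (e k) = a k *: e (k + n)%N) ->
  A' (e k) = if (n <= k)%N then (a (k - n)%N)^* *: e (k - n)%N else 0.
Proof.
move=> AA' Ae; apply: (ip_basis_ext ipN eB) => j.
rewrite (is_adjoint_sym _ _ AA') Ae ipZr (ip_basis eB).
case: leqP => nk.
  rewrite ipZl (ip_basis eB) -[in RHS](eqn_add2r n) subnK //.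
  by case: eqVneq => [->|_]; rewrite ?addnK // !mulr0.
rewrite ip0l (ltn_eqF _) ?mulr0 //.
by rewrite (leq_trans nk) // leq_addl.
Qed.

Lemma span_opnorm_le1 (A : H -> H) :
  (span_opnorm e A <= 1)%E <->
  (forall f, finite_span e f -> `|f| = 1 -> `|A f| <= 1).
Proof.
have Re1 (x : H) : ((complex.Re `|x|)%:E <= 1)%E = (`|x| <= 1).
  by rewrite lee_fin -lecR RRe_real ?normr_real.
split=> [/ereal_supP le1 f Vf f1|le1]; first by rewrite -Re1; apply: le1; exists f.
by apply/ereal_supP => _ [f [Vf f1] <-]; rewrite Re1; exact: le1.
Qed.

(** The quadratic term [|c|^2 [B', B] f] vanishes by hypothesis, leaving an expression linear in [c]
    and [c^*]. *)
Lemma commutator_perturbed A A' B B' c f : B' (B f) = B (B' f) ->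
  commutator (A' \+ c^* \*: B') (A \+ c \*: B) f =
  commutator A' A f + (c *: commutator A' B f + c^* *: commutator B' A f).
Proof.
move=> BB'; rewrite /commutator /= !(linearD, linearZ) /= BB'.
rewrite !scalerDr !scalerN !scalerA [c * c^*]mulrC.
rewrite (addrACA (- A (A' f))) (addrACA (A' (A f) + _)) (addrACA (A' (A f))).
by rewrite (addrACA (c^* *: B' (A f))) subrr addr0 -addrA.
Qed.

End Operators.

Theorem theorem2p1 (R : realType) (H : completeNormedModType R[i])
    (ip : {dot H for Num.conj}) (e : nat -> H) (n : nat)
    (T D : {linear H -> H}) :
  hilbert_norm ip ->
  orthonormal_basis ip e ->
  (1 <= n)%N ->
  bounded_near T (nbhs (0 : H)) ->
  weighted_shift e n T ->
  hyponormal ip T ->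
  [set x | commutator (adjoint ip T) T x = 0] = [set 0] ->
  bounded_near D (nbhs (0 : H)) ->
  diagonal_op e D ->
  forall c : R[i],
    hyponormal ip (T \+ c \*: D) <->
    (span_opnorm e (c \*: J_op ip e T D) <= 1)%E.
Proof.
move=> ipN eB n_gt0 T_bnd [a Te] T_hyp T_ker D_bnd [d De] c.
have [Ts TTs] := exists_adjoint ipN eB T_bnd.
have [Ds DDs] := exists_adjoint ipN eB D_bnd.
have S_adj := is_adjointD c TTs DDs.
rewrite /J_op (adjoint_eq TTs) (adjoint_eq DDs) /hyponormal (adjoint_eq S_adj).
move: T_hyp T_ker; rewrite /hyponormal (adjoint_eq TTs) => T_hyp T_ker.
have Dse k : Ds (e k) = (d k)^* *: e k by exact: (adjoint_diagonal ipN eB k DDs De).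
have Tse k := adjoint_shift ipN eB k TTs Te.
pose P : {linear H -> H} := commutator Ts T.
pose M : {linear H -> H} := commutator Ts D.
pose M' : {linear H -> H} := commutator Ds T.
pose W : {linear H -> H} := M \+ M'.
have M'M : is_adjoint ip M' M := commutator_adjoint TTs DDs.
have W_sym : is_adjoint ip W W.
  move=> x y; rewrite [W x]/(M x + M' x) [W y]/(M y + M' y) ipDl ipDr.
  by rewrite M'M (is_adjoint_sym _ _ M'M) addrC.
have We k : finite_span e (W (e k)).
  have TV j : finite_span e (T (e j)) by rewrite Te; apply: (spanZ eB); exact: span_basis.
  have DV j : finite_span e (D (e j)) by rewrite De; apply: (spanZ eB); exact: span_basis.
  have DsV j : finite_span e (Ds (e j)).
    by rewrite Dse; apply: (spanZ eB); exact: span_basis.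
  have TsV j : finite_span e (Ts (e j)).
    rewrite Tse; case: ifP => _; last exact: span0.
    by apply: (spanZ eB); exact: span_basis.
  apply: (spanD eB); apply: (spanB eB).
  - exact: (span_linear eB TsV (DV k)).
  - exact: (span_linear eB DV (TsV k)).
  - exact: (span_linear eB DsV (TV k)).
  - exact: (span_linear eB TV (DsV k)).
pose p k := ip (P (e k)) (e k).
have P_diag k : P (e k) = p k *: e k.
  (* Being an eigenvector is enough: [p k] is then the eigenvalue, as [e k] is a unit vector. *)
  suff [q Pe] : exists q, P (e k) = q *: e k.
    by rewrite /p Pe ipZl (ip_basis eB) eqxx mulr1.
  have -> : P (e k) = Ts (T (e k)) - T (Ts (e k)) by [].
  rewrite Te linearZ /= !Tse leq_addl addnK scalerA.
  case: leqP => nk; last by rewrite linear0 subr0; exists (a k * (a k)^*).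
  by rewrite linearZ /= Te subnK // scalerA -scalerBl; eexists.
have p_gt0 k : 0 < p k.
  (* Hyponormality at [e k] gives [0 <= p k]; if [p k] were zero, [e k] would lie in the trivial
     kernel. *)
  rewrite lt_neqAle T_hyp andbT eq_sym; apply/eqP => p0.
  have : [set x | commutator Ts T x = 0] (e k) by rewrite /= -/(P (e k)) P_diag p0 scale0r.
  rewrite T_ker /= => ek0; have := ip_basis eB k k.
  by rewrite ek0 ip0l eqxx => /esym/eqP; rewrite oner_eq0.
have M_shift k j : k != (j + n)%N -> ip (M (e k)) (e j) = 0.
  move=> /negPf kj.
  have -> : M (e k) = Ts (D (e k)) - D (Ts (e k)) by [].
  (* Moving every operator onto basis vectors, both terms become multiples of [<e k, e (j + n)>]. *)
  rewrite ipBl.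
  rewrite (is_adjoint_sym _ _ TTs) De Te DDs Dse ipZl !ipZr (is_adjoint_sym _ _ TTs) Te.
  by rewrite ipZr !(ip_basis eB) kj !mulr0 subrr.
have M'_form f : ip (M' f) f = (ip (M f) f)^* by rewrite M'M ip_conj.
have S_form f : finite_span e f ->
    ip (commutator (Ts \+ c^* \*: Ds) (T \+ c \*: D) f) f =
    ip (P f) f + (c * ip (M f) f + (c * ip (M f) f)^*).
  move=> Vf; rewrite commutator_perturbed; last first.
    (* [D] and its adjoint are both diagonal, so they commute on the span. *)
    move: Vf => [N [x ->]]; rewrite !linear_sum; apply: eq_bigr => k _.
    rewrite !linearZ /= !De !linearZ /= !Dse !linearZ /= De.
    by rewrite !scalerA (mulrC (x k)).
  rewrite [LHS]ipDl; congr (_ + _).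
  by rewrite [LHS]ipDl !ipZl M'_form rmorphM.
have S_bnd := bounded_nearD c T_bnd D_bnd.
rewrite (positive_commutator_span ipN eB S_bnd S_adj) span_opnorm_le1.
have rot := rotation_bound eB P_diag n_gt0 M_shift c.
have W_form g : ip (W g) g = ip (M g) g + (ip (M g) g)^*.
  by rewrite [W g]/(M g + M' g) ipDl M'_form.
(* Only the modulus of [c] enters the norm, so the two norm bounds are used with [t = |c|]. *)
have normJ f : `|(c \*: (diag_inv_sqrt ip e P \o W \o diag_inv_sqrt ip e P)) f| =
    `|c| * `|(diag_inv_sqrt ip e P \o W \o diag_inv_sqrt ip e P) f|.
  by rewrite normrZ.
split=> [hyp f Vf f1|nrm].
- rewrite normJ; apply: (form_bound_norm ipN eB P_diag p_gt0 We W_sym) => // g Vg.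
  rewrite W_form; apply: rot.1 g Vg => g Vg.
  by rewrite -S_form //; exact: hyp.
- move=> f Vf; rewrite S_form //; apply: rot.2 f Vf => g Vg; rewrite -W_form.
  apply: (norm_form_bound ipN eB P_diag p_gt0 We) => // f Vf f1.
  by rewrite -normJ; exact: nrm.
Qed.
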